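(* Let $M\ge1$, $\varepsilon>0$, $\lambda_l\in\mathbb{C}$ with $\mathrm{Re}(\lambda_l)<0<\mathrm{Im}(\lambda_l)$, $\beta_1,\dots,\beta_M\in\mathbb{C}$, $r\in\mathbb{R}\setminus\{0\}$, and set $$a(\rho)=\mathrm{Re}(\lambda_l)\rho+\sum_{m=1}^M\mathrm{Re}(\beta_m)\rho^{2m+1},\qquad b(\rho)=\mathrm{Im}(\lambda_l)+\sum_{m=1}^M\mathrm{Im}(\beta_m)\rho^{2m},$$ $$f(\rho,\Omega)=[a(\rho)]^2+[b(\rho)-\Omega]^2\rho^2-\varepsilon^2r^2 .$$ Let $(\rho_{max},\Omega_{max})$, with $\rho_{max}>0$ and $\Omega_{max}>0$, be a point of the response curve $\{f(\rho,\Omega)=0\}$ at which the response amplitude $\rho$, as a function of the forcing frequency $\Omega$ along the curve, is maximal (that is, a point of the backbone curve). Then $$\Omega_{max}=b(\rho_{max})=\mathrm{Im}(\lambda_l)+\sum_{m=1}^M\mathrm{Im}(\beta_m)\rho_{max}^{2m},$$ and the phase shift between response and excitation at this point, $\psi=\arccos\big([\Omega_{max}-b(\rho_{max})]\rho_{max}/(\varepsilon r)\big)$, equals $\pi/2$.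
   Context: The zeros $(\rho,\Omega)$, $\rho>0$, of $f$ are the amplitude-frequency pairs of the periodic responses $z_l(t)=\rho e^{i(\Omega t+\psi)}$, with period $T=2\pi/\Omega$, of the reduced dynamics $\dot z_l=\lambda_lz_l+\sum_{m=1}^M\beta_mz_l^{m+1}\overline{z}_l^{m}+i\varepsilon r e^{i\Omega t}$ on a two-dimensional time-dependent spectral submanifold of a mechanical system forced by $\varepsilon\mathbf{f}\cos(\Omega t)$. The phase shift of such a response relative to the forcing is $\psi=\arccos\big([\Omega-b(\rho)]\rho/(\varepsilon r)\big)$. The backbone curve is the curve of maximal amplitude of the periodic response as a function of the frequency of the external forcing; maximality at $(\rho_{max},\Omega_{max})$ means that no zeros $(\rho,\Omega)$ of $f$ in some neighborhood of $(\rho_{max},\Omega_{max})$ have $\rho>\rho_{max}$. *)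

(* Defs.v *)
From Stdlib Require Import Reals.
From Coquelicot Require Import Coquelicot.
Open Scope R_scope.

(* The coefficients beta_1, ..., beta_M
   are given by a sequence beta : nat -> C; only the indices 1..M are used. *)

Definition amplitude_coeff (M : nat) (lambda : C) (beta : nat -> C) (rho : R) : R :=
  Re lambda * rho
  + sum_n_m (fun m => Re (beta m) * rho ^ (2 * m + 1)) 1 M.

Definition frequency_coeff (M : nat) (lambda : C) (beta : nat -> C) (rho : R) : R :=
  Im lambda
  + sum_n_m (fun m => Im (beta m) * rho ^ (2 * m)) 1 M.

Definition response_fun (M : nat) (eps : R) (lambda : C) (beta : nat -> C) (r : R)
    (rho Omega : R) : R :=
  (amplitude_coeff M lambda beta rho) ^ 2
  + (frequency_coeff M lambda beta rho - Omega) ^ 2 * rho ^ 2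
  - eps ^ 2 * r ^ 2.

(* A point of the response curve where the amplitude is locally maximal: no zero
   in some neighbourhood (in R * R) has larger amplitude.  Since
   rho_max, Omega_max > 0, whether nearby zeros are required to have positive
   amplitude and frequency makes no difference. *)
Definition backbone_point (M : nat) (eps : R) (lambda : C) (beta : nat -> C) (r : R)
    (rho_max Omega_max : R) : Prop :=
  0 < rho_max /\ 0 < Omega_max /\
  response_fun M eps lambda beta r rho_max Omega_max = 0 /\
  locally (rho_max, Omega_max)
    (fun p : R * R =>
       ~ (response_fun M eps lambda beta r (fst p) (snd p) = 0 /\ fst p > rho_max)).

(* On the response curve the argument of acos lies in [-1, 1]. *)
Definition phase_shift (M : nat) (eps : R) (lambda : C) (beta : nat -> C) (r : R)
    (rho Omega : R) : R :=
  acos ((Omega - frequency_coeff M lambda beta rho) * rho / (eps * r)).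

(* Main.v *)
Require Import Defs.
From Stdlib Require Import Reals Lra Lia.
From Coquelicot Require Import Coquelicot.
Open Scope R_scope.

(** The equation [response_fun rho Omega = 0] says that
    [((Omega - b rho) * rho)^2 = eps^2 * r^2 - a rho ^ 2].  At a zero with
    [Omega0 <> b rho0] the right-hand side is positive, so it stays positive
    near [rho0] and its square root of the appropriate sign solves the equation
    for [Omega] as a continuous function of the amplitude
    ([response_branch_zero], [response_branch_continuous]).  The response curve
    therefore continues through such a point to amplitudes larger than [rho0],
    and the amplitude is not maximal there.  Hence [Omega = b rho] at a backbone
    point, and the phase shift is [acos 0]. *)

Lemma continuous_sum_n_m (g : nat -> R -> R) (n k : nat) (x : R) :
  (forall m, continuous (g m) x) ->
  continuous (fun y => sum_n_m (fun m => g m y) n k) x.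
Proof.
  intros Hg. induction k as [|k IH].
  - destruct n as [|n].
    + apply continuous_ext with (g 0%nat); [|apply Hg].
      intros y. now rewrite sum_n_n.
    + apply continuous_ext with (fun _ => zero); [|apply continuous_const].
      intros y. rewrite sum_n_m_zero; [reflexivity|lia].
  - destruct (Compare_dec.le_lt_dec n (S k)) as [Hn|Hn].
    + apply continuous_ext with
        (fun y => plus (sum_n_m (fun m => g m y) n k) (g (S k) y)).
      * intros y. now rewrite sum_n_Sm.
      * apply @continuous_plus; [exact IH|apply Hg].
    + apply continuous_ext with (fun _ => zero); [|apply continuous_const].
      intros y. rewrite sum_n_m_zero; [reflexivity|lia].
Qed.

Lemma continuous_monomial (c : R) (k : nat) (x : R) :
  continuous (fun y => c * y ^ k) x.
Proof.
  apply @ex_derive_continuous. auto_derive. exact I.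
Qed.

Lemma amplitude_coeff_continuous M lambda beta x :
  continuous (amplitude_coeff M lambda beta) x.
Proof.
  apply @continuous_plus.
  - apply (continuous_scal_r (Re lambda) (fun y : R => y)), continuous_id.
  - apply (continuous_sum_n_m (fun m y => Re (beta m) * y ^ (2 * m + 1))).
    intros m. apply continuous_monomial.
Qed.

Lemma frequency_coeff_continuous M lambda beta x :
  continuous (frequency_coeff M lambda beta) x.
Proof.
  apply @continuous_plus; [apply continuous_const|].
  apply (continuous_sum_n_m (fun m y => Im (beta m) * y ^ (2 * m))).
  intros m. apply continuous_monomial.
Qed.

(** The solution of the response equation for the frequency in terms of the
    amplitude [rho].  When [c = (Omega0 - b rho0) * rho0] at a zero
    [(rho0, Omega0)], the factor [c] carries the sign of the square root, and
    the branch passes through [(rho0, Omega0)] because the radicand is then [1]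
    at [rho0]. *)
Definition response_branch M eps lambda beta r (c rho : R) : R :=
  frequency_coeff M lambda beta rho
  + c * sqrt ((eps ^ 2 * r ^ 2 - amplitude_coeff M lambda beta rho ^ 2) / c ^ 2)
    / rho.

Lemma response_branch_zero M eps lambda beta r c rho :
  c <> 0 -> rho <> 0 ->
  0 <= eps ^ 2 * r ^ 2 - amplitude_coeff M lambda beta rho ^ 2 ->
  response_fun M eps lambda beta r rho
    (response_branch M eps lambda beta r c rho) = 0.
Proof.
  intros Hc Hrho Hpos. unfold response_fun, response_branch.
  set (a := amplitude_coeff M lambda beta rho) in *.
  set (b := frequency_coeff M lambda beta rho).
  set (d := (eps ^ 2 * r ^ 2 - a ^ 2) / c ^ 2).
  assert (Hc2 : 0 < c ^ 2) by now apply pow2_gt_0.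
  assert (Hd : 0 <= d) by now apply Rdiv_le_0_compat.
  replace (a ^ 2 + (b - (b + c * sqrt d / rho)) ^ 2 * rho ^ 2 - eps ^ 2 * r ^ 2)
    with (c ^ 2 * (sqrt d) ^ 2 - (eps ^ 2 * r ^ 2 - a ^ 2)) by now field.
  rewrite pow2_sqrt by exact Hd. unfold d. now field.
Qed.

Lemma response_branch_continuous M eps lambda beta r c rho :
  rho <> 0 ->
  continuous (response_branch M eps lambda beta r c) rho.
Proof.
  intros Hrho.
  apply @continuous_plus; [apply frequency_coeff_continuous|].
  apply (continuous_mult (K := R_AbsRing)).
  - apply (continuous_scal_r c (fun y : R =>
      sqrt ((eps ^ 2 * r ^ 2 - amplitude_coeff M lambda beta y ^ 2) / c ^ 2))).
    apply (continuous_comp (amplitude_coeff M lambda beta)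
      (fun u => sqrt ((eps ^ 2 * r ^ 2 - u ^ 2) / c ^ 2))).
    + apply amplitude_coeff_continuous.
    + apply (continuous_comp (fun u => (eps ^ 2 * r ^ 2 - u ^ 2) / c ^ 2) sqrt).
      * apply @ex_derive_continuous. auto_derive. exact I.
      * apply continuous_sqrt.
  - apply @ex_derive_continuous. now auto_derive.
Qed.

(** Off the curve [Omega = b rho], the branch through a zero of the response
    function yields zeros of slightly larger amplitude, so the amplitude has no
    local maximum there. *)
Lemma backbone_point_frequency M eps lambda beta r rho0 Omega0 :
  backbone_point M eps lambda beta r rho0 Omega0 ->
  Omega0 = frequency_coeff M lambda beta rho0.
Proof.
  intros [Hrho [_ [Hzero [delta Hdelta]]]].
  destruct (Req_dec Omega0 (frequency_coeff M lambda beta rho0)) as [H|Hne];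
    [exact H|exfalso].
  pose (c := (Omega0 - frequency_coeff M lambda beta rho0) * rho0).
  pose (h := fun rho =>
    eps ^ 2 * r ^ 2 - amplitude_coeff M lambda beta rho ^ 2).
  assert (Hc : c <> 0) by (apply Rmult_integral_contrapositive; split; lra).
  assert (Hh : h rho0 = c ^ 2)
    by (unfold response_fun in Hzero; unfold h, c; lra).
  assert (Hbranch : response_branch M eps lambda beta r c rho0 = Omega0).
  { unfold response_branch. fold (h rho0).
    rewrite Hh, Rdiv_diag by now apply pow_nonzero.
    rewrite sqrt_1. unfold c. field. lra. }
  assert (Hh_near : locally rho0 (fun rho => 0 < h rho)).
  { assert (Hcont : continuous h rho0).
    { apply (continuous_comp (amplitude_coeff M lambda beta)
        (fun u => eps ^ 2 * r ^ 2 - u ^ 2)).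
      - apply amplitude_coeff_continuous.
      - apply @ex_derive_continuous. auto_derive. exact I. }
    apply (Hcont (fun u => 0 < u)). apply (open_gt 0).
    rewrite Hh. now apply pow2_gt_0. }
  assert (Hbranch_near : locally rho0 (fun rho =>
    ball Omega0 delta (response_branch M eps lambda beta r c rho))).
  { apply (response_branch_continuous M eps lambda beta r c rho0
      (Rgt_not_eq _ _ Hrho) (fun u => ball Omega0 delta u)).
    rewrite Hbranch. apply locally_ball. }
  destruct (filter_and _ _ Hh_near
    (filter_and _ _ Hbranch_near (locally_ball rho0 delta))) as [eta Heta].
  pose proof (cond_pos eta) as Heta_pos.
  destruct (Heta (rho0 + eta / 2)) as [Hpos [HOmega Hball]].
  { change (Rabs (rho0 + eta / 2 - rho0) < eta).
    rewrite Rabs_pos_eq; lra. }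
  apply (Hdelta (rho0 + eta / 2,
    response_branch M eps lambda beta r c (rho0 + eta / 2))).
  - split; assumption.
  - split; simpl; [|lra].
    apply response_branch_zero; [exact Hc|lra|].
    now apply Rlt_le.
Qed.

Theorem mainTheorem5 (M : nat) (eps : R) (lambda : C) (beta : nat -> C) (r : R)
    (rho_max Omega_max : R)
    (hM : (1 <= M)%nat) (heps : 0 < eps)
    (hRe : Re lambda < 0) (hIm : 0 < Im lambda) (hr : r <> 0)
    (hmax : backbone_point M eps lambda beta r rho_max Omega_max) :
  Omega_max = frequency_coeff M lambda beta rho_max /\
  Omega_max = Im lambda + sum_n_m (fun m => Im (beta m) * rho_max ^ (2 * m)) 1 M /\
  phase_shift M eps lambda beta r rho_max Omega_max = PI / 2.
Proof.
  pose proof (backbone_point_frequency _ _ _ _ _ _ _ hmax) as H.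
  split; [exact H|split; [exact H|]].
  unfold phase_shift. rewrite <- H.
  replace ((Omega_max - Omega_max) * rho_max / (eps * r)) with 0
    by (field; split; lra).
  exact acos_0.
Qed.
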